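(* For every positive integer $n$, \[ J(n)=\sum_{k=0}^{\infty}\frac{(-1)^k E_{2k}}{(n+2k+1)!}\left(\frac{\pi}{2}\right)^{n+2k}. \]
   Context: For $\Re(s)>0$, $J(s)=\frac{1}{\Gamma(s+1)}\cdot\frac{2}{\pi}\int_0^{\pi/2}\frac{x^s}{\sin x}\,dx$. The Euler numbers $E_k$ are defined by $\operatorname{sech} t=\sum_{k\ge0}E_k t^k/k!$ (so $E_0=1$, $E_2=-1$, $E_4=5$, $E_6=-61$, and odd-index Euler numbers vanish). *)

(* Defs.v *)
From Stdlib Require Import Arith Factorial Reals Lra Lia.
From Coquelicot Require Import Coquelicot.

Open Scope R_scope.

Definition Cexp (z : C) : C :=
  (exp (Re z) * cos (Im z), exp (Re z) * sin (Im z)).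

(** [x ^ s] for a positive real [x] and a complex exponent [s]; meaningless
    for [x <= 0]. *)
Definition Rcpow (x : R) (s : C) : C := Cexp (s * RtoC (ln x))%C.

(** Euler's integral, for [0 < Re s]. *)
Definition CGamma (s : C) : C :=
  @RInt_gen C_R_CompleteNormedModule
    (fun t : R => (Rcpow t (s - RtoC 1) * RtoC (exp (- t)))%C)
    (at_right 0) (Rbar_locally p_infty).

(** Meant for [0 < Re s]. The integral is improper at [0]. *)
Definition J (s : C) : C :=
  (RtoC 1 / CGamma (s + RtoC 1) * (RtoC 2 / RtoC PI)
   * @RInt_gen C_R_CompleteNormedModule
       (fun x : R => (Rcpow x s / RtoC (sin x))%C)
       (at_right 0%R) (at_point (PI / 2)%R))%C.

(** [sech t = sum_k E k * t ^ k / k!] near [0], which determines [E]. *)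
Definition is_Euler_numbers (E : nat -> R) : Prop :=
  locally 0 (fun t : R =>
    is_pseries (fun k : nat => E k / INR (fact k)) t (/ cosh t)).

(** Existence of the Euler numbers: [sech] is obtained by formally inverting the
    power series of [cosh]. *)

Definition cosh_coef (n : nat) : R := (1 + (-1) ^ n) / 2 / INR (fact n).

Fixpoint sech_coefs (n : nat) : nat -> R :=
  match n with
  | O => fun _ => 1
  | S m => fun k =>
      if Nat.leb k m then sech_coefs m k
      else - sum_f_R0 (fun j => sech_coefs m j * cosh_coef (S m - j)) m
  end.

Definition sech_coef (n : nat) : R := sech_coefs n n.

Lemma sech_coefs_le (m k : nat) : (k <= m)%nat -> sech_coefs m k = sech_coef k.
Proof.
induction m as [|m IH]; intros H.
- now replace k with O by lia.
- destruct (Nat.eq_dec k (S m)) as [->|Hk]; [reflexivity|].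
  simpl. rewrite (proj2 (Nat.leb_le k m)) by lia. apply IH; lia.
Qed.

Lemma sech_coef_S (m : nat) :
  sech_coef (S m)
  = - sum_f_R0 (fun j => sech_coef j * cosh_coef (S m - j)) m.
Proof.
unfold sech_coef at 1; cbn -[sum_f_R0 cosh_coef Nat.sub Nat.leb].
rewrite (proj2 (Nat.leb_gt (S m) m)) by lia.
f_equal; apply sum_eq; intros j Hj; now rewrite sech_coefs_le.
Qed.

Lemma cosh_coef_bound (n : nat) : Rabs (cosh_coef n) <= 1.
Proof.
unfold cosh_coef.
assert (Hf : 1 <= INR (fact n)).
{ change 1 with (INR 1); apply le_INR, lt_O_fact. }
assert (Hi : 0 < / INR (fact n) <= 1).
{ split; [apply Rinv_0_lt_compat; lra|].
  rewrite <- Rinv_1; apply Rinv_le_contravar; lra. }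
assert (Hs : Rabs ((-1) ^ n) = 1) by apply pow_1_abs.
unfold Rdiv at 1; rewrite Rabs_mult, (Rabs_pos_eq (/ _)) by lra.
assert (Rabs ((1 + (-1) ^ n) / 2) <= 1).
{ destruct (Rabs_def2 ((-1) ^ n) 2) as [? ?]; [lra|].
  unfold Rabs in *; destruct (Rcase_abs ((-1) ^ n));
  destruct (Rcase_abs ((1 + (-1) ^ n) / 2)); lra. }
assert (0 <= Rabs ((1 + (-1) ^ n) / 2)) by apply Rabs_pos.
nra.
Qed.

Lemma sech_coef_bound (n : nat) : Rabs (sech_coef n) <= 2 ^ n.
Proof.
induction n as [n IH] using lt_wf_ind.
destruct n as [|m].
- unfold sech_coef; simpl; rewrite Rabs_R1; lra.
- rewrite sech_coef_S, Rabs_Ropp.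
  eapply Rle_trans; [apply Rsum_abs|].
  apply Rle_trans with (sum_f_R0 (fun j => 2 ^ j) m).
  + apply sum_Rle; intros j Hj. rewrite Rabs_mult.
    pose proof (IH j ltac:(lia)). pose proof (cosh_coef_bound (S m - j)).
    pose proof (Rabs_pos (sech_coef j)).
    pose proof (Rabs_pos (cosh_coef (S m - j))). nra.
  + clear IH; enough (sum_f_R0 (fun j => 2 ^ j) m = 2 ^ S m - 1) by lra.
    induction m as [|m IHm]; [simpl; lra|].
    rewrite tech5, IHm; simpl; lra.
Qed.

Lemma sech_cosh_coef (n : nat) :
  PS_mult sech_coef cosh_coef n = if Nat.eqb n 0 then 1 else 0.
Proof.
unfold PS_mult; destruct n as [|m].
- simpl; unfold sech_coef, cosh_coef; simpl; field.
- rewrite tech5, sech_coef_S, Nat.sub_diag.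
  replace (cosh_coef 0) with 1 by (unfold cosh_coef; simpl; field).
  simpl Nat.eqb; cbv iota; ring.
Qed.

Lemma is_pseries_cosh (x : R) : is_pseries cosh_coef x (cosh x).
Proof.
pose proof (is_exp_Reals x) as H1. pose proof (is_exp_Reals (- x)) as H2.
apply is_pseries_R in H1. apply is_pseries_R in H2. apply is_pseries_R.
pose proof (is_series_scal (/ 2) _ _ (is_series_plus _ _ _ _ H1 H2)) as H.
replace (cosh x) with (scal (/ 2) (plus (exp x) (exp (- x)))).
- eapply is_series_ext; [|exact H]. intros k; cbv beta.
  unfold scal, plus, cosh_coef; simpl; unfold mult; simpl.
  replace (- x) with (-1 * x) by ring.
  rewrite Rpow_mult_distr; field; apply INR_fact_neq_0.
- unfold scal, plus, cosh; simpl; unfold mult; simpl; field.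
Qed.

Lemma Euler_numbers_exist : exists E : nat -> R, is_Euler_numbers E.
Proof.
exists (fun k => sech_coef k * INR (fact k)).
exists (mkposreal (/ 2) ltac:(lra)). intros t Ht.
assert (Ht' : Rabs t < / 2).
{ change (Rabs (t - 0) < / 2) in Ht; now rewrite Rminus_0_r in Ht. }
clear Ht.
apply is_pseries_ext with sech_coef.
{ intros k.
  change (sech_coef k = sech_coef k * INR (fact k) / INR (fact k) :> R).
  field; apply INR_fact_neq_0. }
assert (Rs : Rbar_le (/ 2) (CV_radius sech_coef)).
{ apply (proj1 (CV_radius_bounded sech_coef)). exists 1; intros k.
  rewrite Rabs_mult, (Rabs_pos_eq ((/ 2) ^ k)) by (apply pow_le; lra).
  rewrite <- (pow1 k), <- (Rinv_r 2), Rpow_mult_distr by lra.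
  apply Rmult_le_compat_r; [apply pow_le; lra|apply sech_coef_bound]. }
assert (Rc : Rbar_le 1 (CV_radius cosh_coef)).
{ apply (proj1 (CV_radius_bounded cosh_coef)). exists 1; intros k.
  rewrite pow1, Rmult_1_r; apply cosh_coef_bound. }
assert (Ls : Rbar_lt (Rabs t) (CV_radius sech_coef))
  by (eapply Rbar_lt_le_trans; [|exact Rs]; exact Ht').
assert (Lc : Rbar_lt (Rabs t) (CV_radius cosh_coef))
  by (eapply Rbar_lt_le_trans; [|exact Rc]; simpl; lra).
pose proof (PSeries_correct _ _ (CV_radius_inside _ _ Ls)) as Hs.
pose proof (is_pseries_mult _ _ _ _ _ Hs (is_pseries_cosh t) Ls Lc) as Hm.
assert (Hc : 0 < cosh t).
{ unfold cosh; pose proof (exp_pos t); pose proof (exp_pos (- t)); lra. }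
replace (/ cosh t) with (PSeries sech_coef t); [exact Hs|].
apply Rmult_eq_reg_r with (cosh t); [|lra].
rewrite Rinv_l by lra. rewrite <- (is_pseries_unique _ _ _ Hm).
rewrite PSeries_decr_1 by (eexists; exact Hm).
rewrite sech_cosh_coef; simpl Nat.eqb; cbv iota.
rewrite (PSeries_ext _ (fun _ => 0)).
- rewrite PSeries_const_0; ring.
- intros k; unfold PS_decr_1; now rewrite sech_cosh_coef.
Qed.

(* Main.v *)
(** Put [a = PI / 2].  Substituting [a - x] for [x] turns the integral into that of
    [(a - y) ^ n * sec y] over [[0, a]], and the theorem is obtained by integrating
    [sec y = sum_k |E_(2k)| y ^ (2k) / (2k)!] termwise with Euler's beta integral.

    The point is that this series has nonnegative coefficients and converges to
    [sec] up to [a].  Both are read off [f = sec + tan], the solution of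
    [2 f' = 1 + f ^ 2], [f 0 = 1]: the recurrence for the coefficients of [f] has
    only nonnegative terms, so a partial sum [F] satisfies [2 F' <= 1 + F ^ 2] for
    [y >= 0], that is [(atan F)' <= 1 / 2], whence [F y <= tan (PI / 4 + y / 2)].
    This bounds the radius of convergence from below by [a], and then the sum of
    the series satisfies the differential equation itself. *)

Require Import Defs.
From Stdlib Require Import Arith Factorial Reals Lra Lia.
From Coquelicot Require Import Coquelicot.

Open Scope R_scope.

(** * The power series of [sec + tan] *)

(* [sec_tan_coef k] is the coefficient of [y ^ k] in [sec y + tan y], computed
   from the differential equation [2 f' = 1 + f ^ 2], [f 0 = 1]. *)
Fixpoint sec_tan_coefs (n : nat) : nat -> R :=
  match n with
  | O => fun _ => 1
  | S m => fun k =>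
      if Nat.leb k m then sec_tan_coefs m k
      else ((if Nat.eqb m 0 then 1 else 0)
            + sum_f_R0 (fun i => sec_tan_coefs m i * sec_tan_coefs m (m - i)) m)
           / (2 * INR (S m))
  end.

Definition sec_tan_coef (n : nat) : R := sec_tan_coefs n n.

Lemma sec_tan_coefs_le (m k : nat) :
  (k <= m)%nat -> sec_tan_coefs m k = sec_tan_coef k.
Proof.
induction m as [|m IH]; intros H.
- now replace k with O by lia.
- destruct (Nat.eq_dec k (S m)) as [->|Hk]; [reflexivity|].
  cbn [sec_tan_coefs]. rewrite (proj2 (Nat.leb_le k m)) by lia. apply IH; lia.
Qed.

(** Comparison of the coefficients of [y ^ m] in [f' = (1 + f ^ 2) / 2]; the indicator is the series
    of the constant 1. *)
Lemma sec_tan_coef_S (m : nat) :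
  INR (S m) * sec_tan_coef (S m)
  = ((if Nat.eqb m 0 then 1 else 0) + PS_mult sec_tan_coef sec_tan_coef m) / 2.
Proof.
unfold sec_tan_coef at 1; cbn -[sum_f_R0 Nat.sub Nat.leb INR Nat.eqb].
rewrite (proj2 (Nat.leb_gt (S m) m)) by lia.
unfold PS_mult.
replace (sum_f_R0 (fun i => sec_tan_coefs m i * sec_tan_coefs m (m - i)) m)
  with (sum_f_R0 (fun k => sec_tan_coef k * sec_tan_coef (m - k)) m).
- field; apply not_0_INR; lia.
- apply sum_eq; intros i Hi; rewrite !sec_tan_coefs_le by lia; ring.
Qed.

Lemma sec_tan_coef_pos (n : nat) : 0 <= sec_tan_coef n.
Proof.
induction n as [n IH] using lt_wf_ind.
destruct n as [|m]; [unfold sec_tan_coef; simpl; lra|].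
assert (0 < INR (S m)) by (apply lt_0_INR; lia).
apply Rmult_le_reg_l with (INR (S m)); [assumption|].
rewrite Rmult_0_r, sec_tan_coef_S.
assert (0 <= PS_mult sec_tan_coef sec_tan_coef m).
{ unfold PS_mult; rewrite <- (Rmult_0_r (INR (S m))), Rmult_comm, <- sum_cte.
  apply sum_Rle; intros k Hk; apply Rmult_le_pos; apply IH; lia. }
destruct (Nat.eqb m 0); lra.
Qed.

(** * Bounds for the partial sums, and the radius of convergence *)

Definition sec_tan_partial (N : nat) (y : R) : R :=
  sum_f_R0 (fun k => sec_tan_coef k * y ^ k) N.

Lemma is_derive_sum_f_R0_pow (a : nat -> R) (N : nat) (y : R) :
  is_derive (fun y => sum_f_R0 (fun k => a k * y ^ k) (S N)) y
    (sum_f_R0 (fun k => INR (S k) * a (S k) * y ^ k) N).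
Proof.
induction N as [|N IH].
- simpl. auto_derive; [trivial|ring].
- rewrite tech5.
  apply is_derive_ext with
    (fun y => sum_f_R0 (fun k => a k * y ^ k) (S N) + a (S (S N)) * y ^ S (S N)).
  { intros t; symmetry; apply tech5. }
  apply (is_derive_plus (K := R_AbsRing) (V := R_NormedModule)); [exact IH|].
  auto_derive; [trivial|]. change (a (S (S N)) * (1 * (INR (S (S N)) * y ^ S N))
    = INR (S (S N)) * a (S (S N)) * y ^ S N). ring.
Qed.

(** Distributes the power over the convolution, to match the form in which [cauchy_finite] expands a
    product of partial sums. *)
Lemma PS_mult_pow (a b : nat -> R) (y : R) (k : nat) :
  PS_mult a b k * y ^ k
  = sum_f_R0 (fun p => (a p * y ^ p) * (b (k - p)%nat * y ^ (k - p))) k.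
Proof.
unfold PS_mult; rewrite Rmult_comm, scal_sum.
apply sum_eq; intros i Hi.
replace (y ^ k) with (y ^ i * y ^ (k - i)); [ring|].
rewrite <- pow_add; f_equal; lia.
Qed.

Lemma sum_f_R0_indic0 (y : R) (N : nat) :
  sum_f_R0 (fun k => (if Nat.eqb k 0 then 1 else 0) * y ^ k) N = 1.
Proof.
induction N as [|N IH]; [simpl; ring|].
rewrite tech5, IH; simpl; ring.
Qed.

Lemma sec_tan_term_pos (k : nat) (y : R) : 0 <= y -> 0 <= sec_tan_coef k * y ^ k.
Proof.
intros Hy; apply Rmult_le_pos; [apply sec_tan_coef_pos|now apply pow_le].
Qed.

(* Truncation only drops nonnegative terms, so the partial sums are subsolutions
   of [2 f' = 1 + f ^ 2]. *)
Lemma sec_tan_partial_derive_le (N : nat) (y : R) : 0 <= y ->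
  sum_f_R0 (fun k => INR (S k) * sec_tan_coef (S k) * y ^ k) N
  <= (1 + sec_tan_partial (S N) y ^ 2) / 2.
Proof.
intros Hy.
replace (sum_f_R0 (fun k => INR (S k) * sec_tan_coef (S k) * y ^ k) N)
  with ((1 + sum_f_R0 (fun k => PS_mult sec_tan_coef sec_tan_coef k * y ^ k) N)
        / 2).
2:{ rewrite <- (sum_f_R0_indic0 y N) at 1. rewrite <- plus_sum.
    unfold Rdiv; rewrite Rmult_comm, scal_sum.
    apply sum_eq; intros i Hi; rewrite sec_tan_coef_S; field. }
replace (sec_tan_partial (S N) y ^ 2)
  with (sec_tan_partial (S N) y * sec_tan_partial (S N) y) by ring.
(* The square splits into the products of total degree at most [S N] and a remainder [v]. The
   derivative accounts for degrees up to [N] only, so [v] and then the slice [u] of degree [S N] are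
   dropped as nonnegative. *)
unfold sec_tan_partial; rewrite cauchy_finite by lia.
match goal with |- _ <= (1 + (?u + ?v)) / 2 => assert (Hv : 0 <= v) end.
{ apply cond_pos_sum; intros k; apply cond_pos_sum; intros l.
  apply Rmult_le_pos; now apply sec_tan_term_pos. }
rewrite tech5.
match goal with |- _ <= (1 + (_ + ?u + _)) / 2 => assert (Hu : 0 <= u) end.
{ apply cond_pos_sum; intros l; apply Rmult_le_pos; now apply sec_tan_term_pos. }
rewrite (sum_eq _ _ N (fun i _ => PS_mult_pow sec_tan_coef sec_tan_coef y i)).
lra.
Qed.

Lemma is_derive_continuity_pt (f : R -> R) (x l : R) :
  is_derive f x l -> continuity_pt f x.
Proof.
intros H; apply derivable_continuous_pt; exists l; now apply is_derive_Reals.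
Qed.

(** This derivative is nonpositive for a subsolution of [2 f' = 1 + f ^ 2] and zero for a solution.
    The first case serves the partial sums, the second their limit. *)
Lemma is_derive_atan_sub_half (f : R -> R) (x df : R) :
  is_derive f x df ->
  is_derive (fun t => atan (f t) - t / 2) x (df / (1 + f x ^ 2) - / 2).
Proof.
intros H.
apply (is_derive_minus (K := R_AbsRing) (V := R_NormedModule)).
- pose proof (is_derive_comp (K := R_AbsRing) (V := R_NormedModule)
    atan f x _ _ (is_derive_atan _) H) as H1.
  replace (df / (1 + f x ^ 2)) with (scal df (/ (1 + (f x)²)));
    [exact H1|].
  unfold scal; simpl; unfold mult; simpl. unfold Rsqr, Rdiv.
  now replace (f x * (f x * 1)) with (f x * f x) by ring.
- auto_derive; [trivial|field].
Qed.

Lemma sec_tan_partial_0 (N : nat) : sec_tan_partial N 0 = 1.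
Proof.
unfold sec_tan_partial; induction N as [|N IH].
- unfold sec_tan_coef; simpl; ring.
- rewrite tech5, IH; simpl; ring.
Qed.

Lemma atan_sec_tan_partial_le (N : nat) (y : R) : 0 <= y ->
  atan (sec_tan_partial (S N) y) <= PI / 4 + y / 2.
Proof.
intros Hy.
pose proof (fun t => is_derive_atan_sub_half _ _ _
  (is_derive_sum_f_R0_pow sec_tan_coef N t)) as Hd.
destruct (MVT_gen _ 0 y _ (fun t _ => Hd t)) as [c [Hc Heq]].
{ intros t _; exact (is_derive_continuity_pt _ _ _ (Hd t)). }
rewrite Rmin_left, Rmax_right in Hc by lra.
fold (sec_tan_partial (S N) y) (sec_tan_partial (S N) 0)
  (sec_tan_partial (S N) c) in Heq.
rewrite sec_tan_partial_0, atan_1 in Heq.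
pose proof (sec_tan_partial_derive_le N c ltac:(lra)) as Hle.
match type of Heq with _ = (?u / ?v - _) * _ =>
  assert (Hq : u / v <= / 2);
  [apply Rmult_le_reg_r with v|] end.
- pose proof (pow2_ge_0 (sec_tan_partial (S N) c)); lra.
- unfold Rdiv at 1; rewrite Rmult_assoc, Rinv_l; [lra|].
  pose proof (pow2_ge_0 (sec_tan_partial (S N) c)); lra.
- nra.
Qed.

Lemma sec_tan_partial_le (N : nat) (y : R) : 0 <= y < PI / 2 ->
  sec_tan_partial (S N) y <= tan (PI / 4 + y / 2).
Proof.
intros Hy. pose proof PI_RGT_0.
rewrite <- (tan_atan (sec_tan_partial (S N) y)).
destruct (atan_sec_tan_partial_le N y ltac:(lra)) as [Hlt|Heq].
- left; apply tan_increasing; [apply atan_bound|exact Hlt|lra].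
- rewrite Heq; lra.
Qed.

Lemma CV_radius_sec_tan (y : R) :
  Rabs y < PI / 2 -> Rbar_lt (Rabs y) (CV_radius sec_tan_coef).
Proof.
intros Hy. pose proof (Rabs_pos y).
(* A midpoint leaves room on both sides: boundedness of the terms at [r] gives a radius of at least
   [r], which strictly exceeds [Rabs y]. *)
set (r := (Rabs y + PI / 2) / 2).
apply Rbar_lt_le_trans with (Finite r); [unfold r; simpl; lra|].
apply (proj1 (CV_radius_bounded sec_tan_coef)).
assert (Hr : 0 <= r < PI / 2) by (unfold r; lra).
exists (tan (PI / 4 + r / 2)); intros k.
rewrite Rabs_pos_eq by (apply sec_tan_term_pos; lra).
(* The term of index [k] is bounded by the partial sum up to [S k], because the bound on partial
   sums is stated for successor indices. *)
apply Rle_trans with (sec_tan_partial (S k) r);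
  [|now apply sec_tan_partial_le].
unfold sec_tan_partial; rewrite tech5.
pose proof (sec_tan_term_pos (S k) r ltac:(lra)).
destruct k as [|k]; [simpl in *; lra|].
rewrite tech5.
assert (0 <= sum_f_R0 (fun k => sec_tan_coef k * r ^ k) k); [|lra].
apply cond_pos_sum; intros l; apply sec_tan_term_pos; lra.
Qed.

(** * The differential equation for the sum of the series *)

Lemma is_pseries_indic0 (y : R) :
  is_pseries (fun k => if Nat.eqb k 0 then 1 else 0) y 1.
Proof.
apply is_pseries_R.
apply (is_lim_seq_ext (fun _ => 1) _ (Finite 1)); [|apply is_lim_seq_const].
intros N; rewrite sum_n_Reals; symmetry; apply sum_f_R0_indic0.
Qed.

Lemma PSeries_derive_sec_tan (y : R) : Rabs y < PI / 2 ->
  PSeries (PS_derive sec_tan_coef) y = (1 + PSeries sec_tan_coef y ^ 2) / 2.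
Proof.
intros Hy. pose proof (CV_radius_sec_tan y Hy) as Hr.
pose proof (PSeries_correct _ _ (CV_radius_inside _ _ Hr)) as Hf.
pose proof (is_pseries_mult _ _ _ _ _ Hf Hf Hr Hr) as Hm.
pose proof (is_pseries_plus _ _ _ _ _ (is_pseries_indic0 y) Hm) as Hp.
apply is_pseries_R in Hp.
apply is_pseries_unique, is_pseries_R.
replace ((1 + PSeries sec_tan_coef y ^ 2) / 2)
  with (scal (/ 2) (plus 1 (PSeries sec_tan_coef y * PSeries sec_tan_coef y))).
- eapply is_series_ext; [|exact (is_series_scal (/ 2) _ _ Hp)].
  intros k; cbv beta. unfold PS_derive; rewrite sec_tan_coef_S.
  unfold PS_plus, scal, plus; simpl; unfold mult; simpl; field.
- unfold scal, plus; simpl; unfold mult; simpl; field.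
Qed.

(** The derivative of [atan f - t / 2] vanishes on the whole segment between 0 and [y], whatever the
    sign of [y], so this function keeps its value [PI / 4] at 0. *)
Lemma PSeries_sec_tan (y : R) : Rabs y < PI / 2 ->
  PSeries sec_tan_coef y = tan (PI / 4 + y / 2).
Proof.
intros Hy.
assert (Hin : forall t, Rmin 0 y <= t <= Rmax 0 y -> Rabs t < PI / 2).
{ intros t Ht; eapply Rle_lt_trans; [|exact Hy].
  unfold Rmin, Rmax in Ht; destruct (Rle_dec 0 y);
  unfold Rabs; destruct (Rcase_abs t), (Rcase_abs y); lra. }
assert (Hd : forall t, Rmin 0 y <= t <= Rmax 0 y ->
  is_derive (fun t => atan (PSeries sec_tan_coef t) - t / 2) t 0).
{ intros t Ht.
  pose proof (is_derive_atan_sub_half _ _ _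
    (is_derive_PSeries _ _ (CV_radius_sec_tan _ (Hin t Ht)))) as H.
  rewrite PSeries_derive_sec_tan in H by auto.
  match type of H with is_derive _ _ ?v => replace v with 0 in H end;
    [exact H|].
  field. pose proof (pow2_ge_0 (PSeries sec_tan_coef t)); lra. }
destruct (MVT_gen _ 0 y (fun _ => 0) (fun t Ht => Hd t ltac:(lra)))
  as [c [_ Heq]].
{ intros t Ht; exact (is_derive_continuity_pt _ _ _ (Hd t Ht)). }
rewrite PSeries_0 in Heq.
replace (sec_tan_coef 0) with 1 in Heq by reflexivity.
rewrite atan_1 in Heq.
rewrite <- (tan_atan (PSeries sec_tan_coef y)); f_equal; lra.
Qed.

(** * The secant as the even part of [sec + tan] *)

Lemma tan_PI4_add_sub (u : R) : Rabs u < PI / 4 ->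
  (tan (PI / 4 + u) + tan (PI / 4 - u)) / 2 = / cos (2 * u).
Proof.
intros Hu; apply Rabs_def2 in Hu.
assert (0 < cos (PI / 4 + u)) by (apply cos_gt_0; lra).
assert (0 < cos (PI / 4 - u)) by (apply cos_gt_0; lra).
assert (0 < cos (2 * u)) by (apply cos_gt_0; lra).
unfold tan.
(* The two arguments add up to [PI / 2]: the numerator becomes [sin (PI / 2)], and the product
   formula turns the denominator into [cos (PI / 2) + cos (2 * u)]. *)
replace ((sin (PI / 4 + u) / cos (PI / 4 + u)
          + sin (PI / 4 - u) / cos (PI / 4 - u)) / 2)
  with (sin ((PI / 4 + u) + (PI / 4 - u))
        / (2 * (cos (PI / 4 + u) * cos (PI / 4 - u))))
  by (rewrite (sin_plus (PI / 4 + u)); field; lra).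
replace (2 * (cos (PI / 4 + u) * cos (PI / 4 - u)))
  with (cos ((PI / 4 + u) + (PI / 4 - u))
        + cos ((PI / 4 + u) - (PI / 4 - u)))
  by (rewrite (cos_plus (PI / 4 + u)), (cos_minus (PI / 4 + u)); ring).
replace (PI / 4 + u + (PI / 4 - u)) with (PI / 2) by field.
replace (PI / 4 + u - (PI / 4 - u)) with (2 * u) by ring.
rewrite sin_PI2, cos_PI2; field; lra.
Qed.

(** The factor projects onto even indices and so removes [tan], the odd part of [sec + tan]. *)
Definition sec_coef (k : nat) : R := (1 + (-1) ^ k) / 2 * sec_tan_coef k.

Lemma is_pseries_sec (y : R) : Rabs y < PI / 2 ->
  is_pseries sec_coef y (/ cos y).
Proof.
intros Hy.
assert (Hy' : Rabs (- y) < PI / 2) by now rewrite Rabs_Ropp.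
pose proof (PSeries_correct _ _ (CV_radius_inside _ _ (CV_radius_sec_tan _ Hy)))
  as H1.
pose proof (PSeries_correct _ _ (CV_radius_inside _ _ (CV_radius_sec_tan _ Hy')))
  as H2.
apply is_pseries_R in H1. apply is_pseries_R in H2. apply is_pseries_R.
pose proof (is_series_scal (/ 2) _ _ (is_series_plus _ _ _ _ H1 H2)) as H.
rewrite !PSeries_sec_tan in H by assumption.
replace (/ cos y)
  with (scal (/ 2) (plus (tan (PI / 4 + y / 2)) (tan (PI / 4 + - y / 2)))).
- eapply is_series_ext; [|exact H]. intros k; cbv beta.
  unfold scal, plus, sec_coef; simpl; unfold mult; simpl.
  replace (- y) with (-1 * y) by ring.
  rewrite Rpow_mult_distr; field.
- replace (/ cos y) with (/ cos (2 * (y / 2))) by (do 2 f_equal; field).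
  rewrite <- tan_PI4_add_sub.
  + replace (PI / 4 + - y / 2) with (PI / 4 - y / 2) by field.
    unfold scal, plus; simpl; unfold mult; simpl; field.
  + unfold Rdiv; rewrite Rabs_mult, (Rabs_pos_eq (/ 2)) by lra; lra.
Qed.

(** * Comparison with the Euler numbers *)

Lemma ex_pseries_CV_radius (a : nat -> R) (x : R) :
  ex_pseries a x -> Rbar_le (Rabs x) (CV_radius a).
Proof.
intros H; apply Rbar_not_lt_le; intros Hlt.
apply (CV_disk_outside _ _ Hlt).
apply (ex_series_lim_0 (fun n => a n * x ^ n)), ex_pseries_R, H.
Qed.

Lemma locally_is_pseries_CV_radius (a : nat -> R) (f : R -> R) :
  locally 0 (fun t => is_pseries a t (f t)) -> Rbar_lt 0 (CV_radius a).
Proof.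
intros [eps H]. pose proof (cond_pos eps).
apply Rbar_lt_le_trans with (Rabs (eps / 2)).
- rewrite Rabs_pos_eq by lra; simpl; lra.
- apply ex_pseries_CV_radius; eexists; apply H.
  change (Rabs (eps / 2 - 0) < eps).
  rewrite Rminus_0_r, Rabs_pos_eq by lra; lra.
Qed.

Lemma locally_Rabs_lt (r : Rbar) :
  Rbar_lt 0 r -> locally 0 (fun t => Rbar_lt (Rabs t) r).
Proof.
intros Hr.
assert (exists e : posreal, Rbar_le e r) as [e He].
{ destruct r as [r| |]; [exists (mkposreal r Hr); simpl; lra
  |exists (mkposreal 1 Rlt_0_1); exact I|contradiction]. }
exists e; intros t Ht.
apply Rbar_lt_le_trans with e; [|exact He].
change (Rabs (t - 0) < e) in Ht; now rewrite Rminus_0_r in Ht.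
Qed.

(** The product series sums to 1 near 0, and a power series is determined by its sum near 0. Local
    hypotheses suit the Euler numbers, which are specified only by the germ of [sech]. *)
Lemma PS_mult_inverse (a c : nat -> R) (g : R -> R) (n : nat) :
  locally 0 (fun t => g t <> 0) ->
  locally 0 (fun t => is_pseries a t (/ g t)) ->
  locally 0 (fun t => is_pseries c t (g t)) ->
  PS_mult a c n = if Nat.eqb n 0 then 1 else 0.
Proof.
intros Hg Ha Hc.
assert (Hm : locally 0 (fun t => is_pseries (PS_mult a c) t 1)).
{ pose proof (locally_Rabs_lt _ (locally_is_pseries_CV_radius _ _ Ha)) as Ra.
  pose proof (locally_Rabs_lt _ (locally_is_pseries_CV_radius _ _ Hc)) as Rc.
  generalize (filter_and _ _ Hg (filter_and _ _ (filter_and _ _ Ha Hc)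
    (filter_and _ _ Ra Rc))).
  apply filter_imp; intros t (H0 & (H1 & H2) & H3 & H4).
  rewrite <- (Rinv_l (g t)) by assumption.
  now apply is_pseries_mult. }
apply (PSeries_ext_recip _ (fun k => if Nat.eqb k 0 then 1 else 0)).
- exact (locally_is_pseries_CV_radius _ _ Hm).
- apply (locally_is_pseries_CV_radius _ (fun _ => 1)).
  apply filter_forall, is_pseries_indic0.
- revert Hm; apply filter_imp; intros t Ht.
  transitivity 1; [|symmetry]; apply is_pseries_unique;
    [exact Ht|apply is_pseries_indic0].
Qed.

(** Encodes [cos t = cosh (i t)]: for even [k] the sign is [i ^ k], and for odd [k] the factor
    [cosh_coef k] is zero, so the rounding in [k / 2] is harmless. *)
Definition cos_coef (k : nat) : R := (-1) ^ (k / 2) * cosh_coef k.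

Lemma is_pseries_cos (y : R) : is_pseries cos_coef y (cos y).
Proof.
(* Separates the even part, which is the series in the square of [y] defining [cos], from an odd
   part equal to zero. *)
replace (cos y) with (cos y + y * 0) by ring.
apply is_pseries_odd_even.
- apply is_pseries_R, is_series_Reals.
  unfold cos; destruct (exist_cos (y²)) as [l Hl].
  replace (y ^ 2) with (y²) by (unfold Rsqr; ring).
  eapply is_series_Reals, is_series_ext; [|apply is_series_Reals, Hl].
  intros k; cbv beta; f_equal.
  unfold cos_n, cos_coef, cosh_coef.
  rewrite Nat.mul_comm, Nat.div_mul, (Nat.mul_comm k 2), pow_1_even by lia.
  field; apply INR_fact_neq_0.
- apply is_pseries_R.
  apply (is_lim_seq_ext (fun _ => 0) _ (Finite 0)); [|apply is_lim_seq_const].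
  intros N; rewrite sum_n_Reals; symmetry; apply sum_eq_R0; intros k Hk.
  unfold cos_coef, cosh_coef.
  rewrite Nat.add_1_r, pow_1_odd; field; apply INR_fact_neq_0.
Qed.

(* [(-1) ^ (k / 2)] is multiplicative when one of the two summands is even, and
   the odd coefficients of [cosh] vanish. *)
Lemma sign_half_cosh_coef (j k : nat) : (j <= k)%nat ->
  (-1) ^ (j / 2) * cos_coef (k - j) = (-1) ^ (k / 2) * cosh_coef (k - j).
Proof.
intros Hjk; unfold cos_coef.
destruct (Nat.Even_or_Odd (k - j)) as [[m Hm]|[m Hm]]; rewrite Hm.
- replace k with (j + m * 2)%nat by lia.
  rewrite Nat.div_add, pow_add by lia.
  replace (2 * m / 2)%nat with m
    by (rewrite Nat.mul_comm, Nat.div_mul by lia; reflexivity).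
  ring.
- unfold cosh_coef; rewrite Nat.add_1_r, pow_1_odd.
  unfold Rdiv; ring.
Qed.

(** The identity [sec t = sech (i t)] on coefficients. Since [cosh_coef] and [cos_coef] start with
    1, each hypothesis determines its sequence recursively, and the sign carries one recursion to
    the other. *)
Lemma PS_mult_inverse_twist (a b : nat -> R) :
  (forall n, PS_mult a cosh_coef n = if Nat.eqb n 0 then 1 else 0) ->
  (forall n, PS_mult b cos_coef n = if Nat.eqb n 0 then 1 else 0) ->
  forall n, b n = (-1) ^ (n / 2) * a n.
Proof.
intros Ha Hb n; induction n as [n IH] using lt_wf_ind.
pose proof (Ha n) as Han. pose proof (Hb n) as Hbn.
assert (H0 : cosh_coef 0 = 1) by (unfold cosh_coef; simpl; field).
assert (H1 : cos_coef 0 = 1) by (unfold cos_coef; rewrite H0; simpl; ring).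
unfold PS_mult in Han, Hbn.
destruct n as [|m].
- simpl in Han, Hbn; rewrite H0 in Han; rewrite H1 in Hbn; simpl; lra.
- rewrite tech5, Nat.sub_diag, H0 in Han.
  rewrite tech5, Nat.sub_diag, H1 in Hbn.
  simpl Nat.eqb in *; cbv iota in *.
  rewrite (sum_eq _ (fun j => a j * cosh_coef (S m - j) * (-1) ^ (S m / 2)))
    in Hbn.
  + rewrite <- scal_sum in Hbn.
    replace (b (S m))
      with (- ((-1) ^ (S m / 2)
              * sum_f_R0 (fun j => a j * cosh_coef (S m - j)) m)) by lra.
    replace (sum_f_R0 (fun j => a j * cosh_coef (S m - j)) m)
      with (- a (S m)) by lra.
    ring.
  + intros j Hj; rewrite IH by lia.
    transitivity (a j * ((-1) ^ (j / 2) * cos_coef (S m - j))); [ring|].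
    rewrite sign_half_cosh_coef by lia; ring.
Qed.

Lemma Euler_numbers_sec_coef (E : nat -> R) (k : nat) : is_Euler_numbers E ->
  sec_tan_coef (2 * k) = (-1) ^ k * E (2 * k)%nat / INR (fact (2 * k)).
Proof.
intros hE.
assert (Ha : forall n, PS_mult (fun k => E k / INR (fact k)) cosh_coef n
                       = if Nat.eqb n 0 then 1 else 0).
{ intros n; apply (PS_mult_inverse _ _ cosh).
  - apply filter_forall; intros t; unfold cosh.
    pose proof (exp_pos t); pose proof (exp_pos (- t)); lra.
  - exact hE.
  - apply filter_forall, is_pseries_cosh. }
assert (Hb : forall n, PS_mult sec_coef cos_coef n
                       = if Nat.eqb n 0 then 1 else 0).
{ assert (HP : Rbar_lt 0 (PI / 2)) by (pose proof PI_RGT_0; simpl; lra).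
  intros n; apply (PS_mult_inverse _ _ cos).
  - generalize (locally_Rabs_lt _ HP); apply filter_imp; intros t Ht.
    apply Rabs_def2 in Ht; apply Rgt_not_eq, cos_gt_0; lra.
  - generalize (locally_Rabs_lt _ HP); apply filter_imp; intros t Ht.
    now apply is_pseries_sec.
  - apply filter_forall, is_pseries_cos. }
(* At the index [2 * k] the twist is [(-1) ^ k] and the projection factor in [sec_coef] is 1. *)
pose proof (PS_mult_inverse_twist _ _ Ha Hb (2 * k)) as H.
unfold sec_coef in H; rewrite pow_1_even in H.
replace (2 * k / 2)%nat with k in H
  by (rewrite Nat.mul_comm, Nat.div_mul by lia; reflexivity).
unfold Rdiv in *; lra.
Qed.

Lemma is_series_sec_even (y : R) : Rabs y < PI / 2 ->
  is_series (fun k => sec_tan_coef (2 * k) * y ^ (2 * k)) (/ cos y).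
Proof.
intros Hy.
pose proof (is_pseries_sec y Hy) as H; apply is_pseries_R in H.
change (is_lim_seq (sum_n (fun n => sec_coef n * y ^ n)) (/ cos y)) in H.
(* The odd coefficients vanish, so the full partial sum up to [2 * N] is the even one up to [N]. *)
apply (is_lim_seq_subseq _ _ (fun N => 2 * N)%nat) in H.
2:{ apply eventually_subseq; intros N; lia. }
refine (is_lim_seq_ext _ _ _ _ H).
intros N; rewrite !sum_n_Reals; induction N as [|N IH].
- unfold sec_coef; simpl; field.
- replace (2 * S N)%nat with (S (S (2 * N))) at 1 by lia.
  rewrite !tech5, IH.
  replace (S (S (2 * N))) with (2 * S N)%nat by lia.
  unfold sec_coef; rewrite pow_1_odd, pow_1_even; field.
Qed.

(** * Termwise integration *)

(** Integration by parts trades a power of [x] for a power of [a - x]; hence the induction on [n]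
    with [k] general. *)
Lemma is_RInt_beta (a : R) (n k : nat) :
  is_RInt (fun x => x ^ n * (a - x) ^ k) 0 a
    (INR (fact n) * INR (fact k) / INR (fact (n + k + 1)) * a ^ (n + k + 1)).
Proof.
revert k; induction n as [|n IH]; intros k.
- pose proof (is_RInt_derive (V := R_CompleteNormedModule)
    (fun x => - (a - x) ^ S k / INR (S k))
    (fun x => x ^ 0 * (a - x) ^ k) 0 a) as H.
  match goal with |- is_RInt _ _ _ ?v => match type of H with
    _ -> _ -> is_RInt _ _ _ ?w => replace v with w end end.
  + apply H; intros x _.
    * auto_derive; [trivial|].
      change (match k with 0%nat => 1 | S _ => INR k + 1 end) with (INR (S k)).
      change (a + - x) with (a - x). simpl pow. field; apply (not_0_INR (S k)); lia.
    * apply (ex_derive_continuous (K := R_AbsRing) (V := R_NormedModule)).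
      auto_derive; trivial.
  + unfold minus, plus, opp; simpl plus.
    replace (0 + k + 1)%nat with (S k) by lia.
    rewrite fact_simpl, mult_INR.
    change (- (a - a) ^ S k / INR (S k) + - (- (a - 0) ^ S k / INR (S k))
      = INR (fact 0) * INR (fact k) / (INR (S k) * INR (fact k)) * a ^ S k).
    rewrite Rminus_diag, Rminus_0_r, pow_ne_zero by lia.
    simpl fact; simpl (INR 1).
    field; split; [apply INR_fact_neq_0|apply not_0_INR; lia].
(* With this ratio the integrand below is the derivative of [- x ^ S n * (a - x) ^ S k / INR (S k)],
   which vanishes at both ends. *)
- set (c := INR (S n) / INR (S k)).
  pose proof (is_RInt_derive (V := R_CompleteNormedModule)
    (fun x => - x ^ S n * (a - x) ^ S k / INR (S k))
    (fun x => x ^ S n * (a - x) ^ k - c * (x ^ n * (a - x) ^ S k)) 0 a) as H.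
  assert (Hk : INR (S k) <> 0) by (apply not_0_INR; lia).
  assert (H' : is_RInt
    (fun x => x ^ S n * (a - x) ^ k - c * (x ^ n * (a - x) ^ S k)) 0 a 0).
  { replace 0 with (minus (- a ^ S n * (a - a) ^ S k / INR (S k))
       (- 0 ^ S n * (a - 0) ^ S k / INR (S k))) at 2.
    - apply H; intros x _.
      + auto_derive; [trivial|].
        change (match k with 0%nat => 1 | S _ => INR k + 1 end) with (INR (S k)).
        change (match n with 0%nat => 1 | S _ => INR n + 1 end) with (INR (S n)).
        change (a + - x) with (a - x). unfold c; simpl pow. field; exact Hk.
      + apply (ex_derive_continuous (K := R_AbsRing) (V := R_NormedModule)).
        auto_derive; trivial.
    - rewrite Rminus_diag, !pow_ne_zero by lia.
      change (- a ^ S n * 0 / INR (S k) + - (- 0 * (a - 0) ^ S k / INR (S k)) = 0).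
      field; exact Hk. }
  pose proof (is_RInt_plus _ _ _ _ _ _ H' (is_RInt_scal _ _ _ c _ (IH (S k))))
    as H2.
  replace (INR (fact (S n)) * INR (fact k) / INR (fact (S n + k + 1))
           * a ^ (S n + k + 1))
    with (plus 0 (scal c (INR (fact n) * INR (fact (S k))
            / INR (fact (n + S k + 1)) * a ^ (n + S k + 1)))).
  + eapply is_RInt_ext; [|exact H2].
    intros x _; cbv beta; unfold scal, plus; simpl; unfold mult; simpl; ring.
  + replace (n + S k + 1)%nat with (S n + k + 1)%nat by lia.
    rewrite (fact_simpl n), (fact_simpl k), !mult_INR.
    unfold c, scal, plus; simpl plus; unfold mult; simpl mult.
    change (0 + INR (S n) / INR (S k)
       * (INR (fact n) * (INR (S k) * INR (fact k)) / INR (fact (S n + k + 1))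
          * a ^ (S n + k + 1)) =
      INR (S n) * INR (fact n) * INR (fact k) / INR (fact (S n + k + 1))
        * a ^ (S n + k + 1)).
    field; split; [apply INR_fact_neq_0|exact Hk].
Qed.

(** From [sin x >= x - x ^ 3 / 6] and [x ^ 2 <= 4]. A crude linear bound suffices to control
    [x ^ n / sin x] near 0. *)
Lemma third_le_sin (x : R) : 0 <= x <= PI / 2 -> x / 3 <= sin x.
Proof.
intros Hx. pose proof PI_4.
destruct (pre_sin_bound x 0) as [Hs _]; [lra..|].
eapply Rle_trans; [|exact Hs].
unfold sin_approx, sin_term; simpl.
replace (1 * (x * 1 / 1) + -1 * 1 * (x * (x * (x * 1)) / (1 + 1 + 1 + 1 + 1 + 1)))
  with (x - x * (x * x) / 6) by field.
assert (x * x <= 4) by nra. nra.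
Qed.

(** * The cosecant series and its moments *)

Lemma is_series_csc (x : R) : 0 < x <= PI / 2 ->
  is_series (fun k => sec_tan_coef (2 * k) * (PI / 2 - x) ^ (2 * k)) (/ sin x).
Proof.
intros Hx; rewrite <- cos_shift; apply is_series_sec_even.
apply Rabs_def1; lra.
Qed.

Definition csc_partial (N : nat) (x : R) : R :=
  sum_f_R0 (fun k => sec_tan_coef (2 * k) * (PI / 2 - x) ^ (2 * k)) N.

Lemma is_lim_seq_csc_partial (x : R) : 0 < x <= PI / 2 ->
  is_lim_seq (fun N => csc_partial N x) (/ sin x).
Proof.
intros Hx; apply (is_lim_seq_ext _ _ _ (fun N => sum_n_Reals _ N)).
exact (is_series_csc x Hx).
Qed.

Lemma csc_partial_incr (x : R) (N M : nat) : x <= PI / 2 -> (N <= M)%nat ->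
  csc_partial N x <= csc_partial M x.
Proof.
intros Hx H; induction H as [|M _ IH]; [lra|].
unfold csc_partial at 2; rewrite tech5; fold (csc_partial M x).
pose proof (sec_tan_term_pos (2 * S M) (PI / 2 - x) ltac:(lra)); lra.
Qed.

Lemma csc_partial_le (x : R) (N : nat) : 0 < x <= PI / 2 ->
  csc_partial N x <= / sin x.
Proof.
intros Hx.
apply (is_lim_seq_incr_compare (fun N => csc_partial N x));
  [now apply is_lim_seq_csc_partial|].
intros M; apply csc_partial_incr; [lra|lia].
Qed.

(* All terms decrease in [x], hence so does the tail: this makes the convergence
   uniform on [[c, PI / 2]]. *)
Lemma csc_tail_le (c x : R) (N : nat) : 0 < c <= x -> x <= PI / 2 ->
  / sin x - csc_partial N x <= / sin c - csc_partial N c.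
Proof.
intros Hc Hx.
assert (H : Rbar_le (/ sin x - csc_partial N x) (/ sin c - csc_partial N c));
  [|exact H].
apply is_lim_seq_le with
  (* Shifting the index by [N] leaves exactly the terms after [N], which are compared one by one
     before the limit. *)
  (fun M => csc_partial (M + N) x - csc_partial N x)
  (fun M => csc_partial (M + N) c - csc_partial N c).
- intros M; induction M as [|M IH]; [simpl; lra|].
  change (S M + N)%nat with (S (M + N)).
  unfold csc_partial at 1 3; rewrite !tech5.
  fold (csc_partial (M + N) x) (csc_partial (M + N) c).
  enough (sec_tan_coef (2 * S (M + N)) * (PI / 2 - x) ^ (2 * S (M + N))
    <= sec_tan_coef (2 * S (M + N)) * (PI / 2 - c) ^ (2 * S (M + N))) by lra.
  apply Rmult_le_compat_l; [apply sec_tan_coef_pos|apply pow_incr; lra].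
- apply is_lim_seq_minus';
    [apply -> (is_lim_seq_incr_n (fun M => csc_partial M x))
    |apply is_lim_seq_const].
  apply is_lim_seq_csc_partial; lra.
- apply is_lim_seq_minus';
    [apply -> (is_lim_seq_incr_n (fun M => csc_partial M c))
    |apply is_lim_seq_const].
  apply is_lim_seq_csc_partial; lra.
Qed.

Definition csc_moment_term (n k : nat) : R :=
  sec_tan_coef (2 * k)
  * (INR (fact n) * INR (fact (2 * k)) / INR (fact (n + 2 * k + 1))
     * (PI / 2) ^ (n + 2 * k + 1)).

Lemma is_RInt_csc_partial (n N : nat) :
  is_RInt (fun x => x ^ n * csc_partial N x) 0 (PI / 2)
    (sum_f_R0 (csc_moment_term n) N).
Proof.
assert (H : forall k, is_RInt
  (fun x => x ^ n * (sec_tan_coef (2 * k) * (PI / 2 - x) ^ (2 * k)))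
  0 (PI / 2) (csc_moment_term n k)).
{ intros k; eapply is_RInt_ext;
    [|exact (is_RInt_scal _ _ _ (sec_tan_coef (2 * k)) _
        (is_RInt_beta (PI / 2) n (2 * k)))].
  intros x _; unfold scal; simpl; unfold mult; simpl; ring. }
induction N as [|N IH]; [exact (H 0%nat)|].
rewrite tech5.
eapply is_RInt_ext; [|exact (is_RInt_plus _ _ _ _ _ _ IH (H (S N)))].
intros x _; unfold csc_partial; rewrite tech5.
symmetry; apply Rmult_plus_distr_l.
Qed.

(** [P] and [M] do not depend on [c], so the estimate gives convergence of the improper integral to
    [P] as [c] tends to 0. The series is integrated termwise by uniform convergence on [[c, PI / 2]]
    and by the bound [M] on the rest. *)
Lemma csc_moment (n : nat) : (1 <= n)%nat ->
  exists P M, is_series (csc_moment_term n) P /\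
    forall c, 0 < c < PI / 2 ->
    exists G, is_RInt (fun x => x ^ n / sin x) c (PI / 2) G
              /\ Rabs (G - P) <= c * M.
Proof.
intros hn. pose proof PI_RGT_0 as Hpi.
set (a := PI / 2) in *.
(* The bound [x / 3 <= sin x] gives [x ^ n / sin x <= 3 * x ^ (n - 1)]; here [n >= 1] matters. *)
set (M := 3 * a ^ (n - 1)).
assert (HM : forall x, 0 < x <= a -> x ^ n / sin x <= M).
{ intros x Hx. assert (Hs := third_le_sin x ltac:(unfold a in Hx; lra)).
  assert (0 < sin x) by lra.
  apply Rmult_le_reg_r with (sin x); [assumption|].
  unfold Rdiv; rewrite Rmult_assoc, Rinv_l, Rmult_1_r by lra.
  replace n with (S (n - 1)) at 1 by lia; unfold M; simpl pow.
  assert (0 <= x ^ (n - 1) <= a ^ (n - 1))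
    by (split; [apply pow_le|apply pow_incr]; lra).
  apply Rle_trans with (x * a ^ (n - 1)); [apply Rmult_le_compat_l; lra|].
  nra. }
assert (HU : forall N x, 0 < x <= a -> x ^ n * csc_partial N x <= x ^ n / sin x).
{ intros N x Hx; apply Rmult_le_compat_l; [apply pow_le; lra|].
  apply csc_partial_le; unfold a in Hx; lra. }
assert (HU0 : forall N x, x <= a -> 0 <= csc_partial N x).
{ intros N x Hx; apply cond_pos_sum; intros k.
  apply sec_tan_term_pos; unfold a in Hx; lra. }
(* The sums increase and are integrals of functions bounded by [M] on the open interval from 0 to
   [a], where the comparison with [/ sin x] makes sense. *)
assert (HP : ex_finite_lim_seq (sum_f_R0 (csc_moment_term n))).
{ apply ex_finite_lim_seq_incr with (a * M).
  - intros N; rewrite tech5.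
    assert (0 <= csc_moment_term n (S N)); [|lra].
    unfold csc_moment_term; apply Rmult_le_pos; [apply sec_tan_coef_pos|].
    apply Rmult_le_pos; [|apply pow_le; lra].
    apply Rmult_le_pos; [apply Rmult_le_pos; apply pos_INR|].
    left; apply Rinv_0_lt_compat, INR_fact_lt_0.
  - intros N.
    apply (is_RInt_le (fun x => x ^ n * csc_partial N x) (fun _ => M) 0 a).
    + unfold a; lra.
    + apply is_RInt_csc_partial.
    + replace (a * M) with (scal (a - 0) M)
        by (unfold scal; simpl; unfold mult; simpl; ring).
      apply (is_RInt_const (V := R_NormedModule)).
    + intros x Hx; apply Rle_trans with (x ^ n / sin x); [apply HU|apply HM]; lra. }
destruct HP as [P HP]. exists P, M; split.
{ apply (is_lim_seq_ext _ _ (Finite P) (fun N => eq_sym (sum_n_Reals _ N))).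
  exact HP. }
intros c Hc.
assert (HG : ex_RInt (fun x => x ^ n / sin x) c a).
{ apply (ex_RInt_continuous (V := R_CompleteNormedModule)).
  intros x Hx; rewrite Rmin_left, Rmax_right in Hx by lra.
  apply (ex_derive_continuous (K := R_AbsRing) (V := R_NormedModule)).
  auto_derive. apply Rgt_not_eq, sin_gt_0; unfold a in Hx; lra. }
destruct HG as [G HG]; exists G; split; [exact HG|].
assert (Hsplit : forall N, exists A B,
  is_RInt (fun x => x ^ n * csc_partial N x) 0 c A /\
  is_RInt (fun x => x ^ n * csc_partial N x) c a B /\
  A + B = sum_f_R0 (csc_moment_term n) N).
{ intros N. pose proof (is_RInt_csc_partial n N) as H. fold a in H.
  destruct (ex_RInt_Chasles_1 (V := R_CompleteNormedModule)
    (fun x => x ^ n * csc_partial N x) 0 c a ltac:(lra) (ex_intro _ _ H)) as [A HA].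
  destruct (ex_RInt_Chasles_2 (V := R_CompleteNormedModule)
    (fun x => x ^ n * csc_partial N x) 0 c a ltac:(lra) (ex_intro _ _ H)) as [B HB].
  exists A, B; split; [exact HA|split; [exact HB|]].
  pose proof (is_RInt_Chasles _ _ _ _ _ _ HA HB) as HAB.
  rewrite <- (is_RInt_unique _ _ _ _ H).
  symmetry; exact (is_RInt_unique _ _ _ _ HAB). }
(* Upper bound: on [[c, a]] the tail is at most its value at [c] and [x ^ n <= a ^ n], so [G]
   exceeds [B] by at most a quantity tending to 0 with [N]; [A >= 0] lets the full sum replace
   [B]. *)
assert (Hup : Rbar_le G P).
{ apply is_lim_seq_le with (fun _ => G)
    (fun N => sum_f_R0 (csc_moment_term n) N
              + (a - c) * (a ^ n * (/ sin c - csc_partial N c))).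
  - intros N; destruct (Hsplit N) as (A & B & HA & HB & HAB).
    assert (HA0 : 0 <= A).
    { apply (is_RInt_le (fun _ => 0) (fun x => x ^ n * csc_partial N x) 0 c);
        [lra| |exact HA|].
      - replace 0 with (scal (c - 0) 0) at 2
          by (unfold scal; simpl; unfold mult; simpl; ring).
        apply (is_RInt_const (V := R_NormedModule)).
      - intros x Hx; apply Rmult_le_pos; [apply pow_le; lra|apply HU0; lra]. }
    set (t := a ^ n * (/ sin c - csc_partial N c)).
    pose proof (is_RInt_plus _ _ _ _ _ _ HB (is_RInt_const c a t)) as HBt.
    assert (G <= B + (a - c) * t); [|lra].
    refine (is_RInt_le _ _ c a _ _ ltac:(lra) HG HBt _).
    intros x Hx; unfold plus; simpl.
    apply Rle_trans with (x ^ n * csc_partial N x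
      + x ^ n * (/ sin x - csc_partial N x)); [right; unfold Rdiv; ring|].
    apply Rplus_le_compat_l; unfold t.
    apply Rmult_le_compat.
    + apply pow_le; lra.
    + pose proof (csc_partial_le x N ltac:(unfold a in Hx; lra)); lra.
    + apply pow_incr; lra.
    + apply csc_tail_le; unfold a in Hx; lra.
  - apply is_lim_seq_const.
  - replace (Finite P)
      with (Finite (P + (a - c) * (a ^ n * (/ sin c - / sin c))))
      by (f_equal; ring).
    apply is_lim_seq_plus'; [exact HP|].
    apply (is_lim_seq_scal_l _ (a - c) (a ^ n * (/ sin c - / sin c))).
    apply (is_lim_seq_scal_l _ (a ^ n) (/ sin c - / sin c)).
    apply is_lim_seq_minus'; [apply is_lim_seq_const|].
    apply is_lim_seq_csc_partial; unfold a in Hc; lra. }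
(* Lower bound: [B <= G] because partial sums lie below [/ sin x], and [A <= c * M] because the
   integrand is at most [M]. *)
assert (Hlo : Rbar_le P (G + c * M)).
{ apply is_lim_seq_le with (sum_f_R0 (csc_moment_term n)) (fun _ => G + c * M).
  - intros N; destruct (Hsplit N) as (A & B & HA & HB & HAB).
    assert (HAM : A <= c * M).
    { apply (is_RInt_le (fun x => x ^ n * csc_partial N x) (fun _ => M) 0 c);
        [lra|exact HA| |].
      - replace (c * M) with (scal (c - 0) M)
          by (unfold scal; simpl; unfold mult; simpl; ring).
        apply (is_RInt_const (V := R_NormedModule)).
      - intros x Hx; apply Rle_trans with (x ^ n / sin x);
          [apply HU|apply HM]; lra. }
    assert (B <= G); [|lra].
    refine (is_RInt_le _ _ c a _ _ ltac:(lra) HB HG _).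
    intros x Hx; apply HU; lra.
  - exact HP.
  - apply is_lim_seq_const. }
simpl in Hup, Hlo; apply Rabs_le; lra.
Qed.

(** * The Gamma function at integers and complex-valued integrals *)

(* [n! * sum_(k <= n) t ^ k / k!]: [- exp (- t)] times it is an antiderivative of
   [t ^ n * exp (- t)]. *)
Fixpoint gamma_poly (n : nat) (t : R) : R :=
  match n with
  | O => 1
  | S m => t ^ S m + INR (S m) * gamma_poly m t
  end.

Lemma is_derive_gamma_poly (n : nat) (t : R) :
  is_derive (gamma_poly n) t (gamma_poly n t - t ^ n).
Proof.
induction n as [|n IH].
- simpl; auto_derive; [trivial|ring].
- change (gamma_poly (S n))
    with (fun t => t ^ S n + INR (S n) * gamma_poly n t); cbv beta.
  replace (t ^ S n + INR (S n) * gamma_poly n t - t ^ S n)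
    with (INR (S n) * t ^ n + INR (S n) * (gamma_poly n t - t ^ n))
    by (simpl pow; ring).
  apply (is_derive_plus (K := R_AbsRing) (V := R_NormedModule)).
  + auto_derive; [trivial|].
    change (match n with 0%nat => 1 | S _ => INR n + 1 end) with (INR (S n)).
    ring.
  + exact (is_derive_scal _ _ (INR (S n)) _ IH).
Qed.

Lemma is_derive_gamma_primitive (n : nat) (t : R) :
  is_derive (fun t => - (gamma_poly n t * exp (- t))) t (t ^ n * exp (- t)).
Proof.
assert (He : is_derive (fun t => exp (- t)) t (- exp (- t)))
  by (auto_derive; [trivial|ring]).
pose proof (is_derive_opp (K := R_AbsRing) (V := R_NormedModule) _ _ _
  (is_derive_mult _ _ _ _ _ (is_derive_gamma_poly n t) He Rmult_comm)) as H.
match type of H with is_derive _ _ ?v =>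
  replace (t ^ n * exp (- t)) with v end; [exact H|].
unfold opp, plus; simpl; unfold mult; simpl; ring.
Qed.

Lemma gamma_poly_0 (n : nat) : gamma_poly n 0 = INR (fact n).
Proof.
induction n as [|n IH]; [reflexivity|].
change (0 ^ S n + INR (S n) * gamma_poly n 0 = INR (fact (S n))).
rewrite IH, fact_simpl, mult_INR, pow_ne_zero by lia; ring.
Qed.

(** The Taylor bound [t ^ S k / INR (fact (S k)) <= exp t] dominates the function by a multiple of
    [/ t]. *)
Lemma is_lim_pow_exp_opp (k : nat) :
  is_lim (fun t => t ^ k * exp (- t)) p_infty 0.
Proof.
apply (is_lim_le_le_loc (fun _ => 0) (fun t => INR (fact (S k)) * / t)).
- exists 0; intros t Ht.
  assert (Htk : 0 < t ^ k) by now apply pow_lt.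
  pose proof (exp_pos (- t)).
  split; [apply Rmult_le_pos; lra|].
  assert (Hexp : t ^ S k / INR (fact (S k)) <= exp t).
  { eapply Rle_trans; [|apply (exp_ge_taylor t (S k)); lra].
    rewrite tech5.
    assert (0 <= sum_f_R0 (fun k => t ^ k / INR (fact k)) k); [|lra].
    apply cond_pos_sum; intros j; apply Rmult_le_pos; [apply pow_le; lra|].
    left; apply Rinv_0_lt_compat, INR_fact_lt_0. }
  pose proof (INR_fact_lt_0 (S k)).
  apply Rmult_le_reg_r with (t * exp t); [apply Rmult_lt_0_compat;
    [exact Ht|apply exp_pos]|].
  replace (t ^ k * exp (- t) * (t * exp t)) with (t ^ S k * (exp (- t) * exp t))
    by (simpl; ring).
  rewrite <- exp_plus, Rplus_opp_l, exp_0, Rmult_1_r.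
  replace (INR (fact (S k)) * / t * (t * exp t)) with (INR (fact (S k)) * exp t)
    by (field; lra).
  apply Rmult_le_reg_r with (/ INR (fact (S k)));
    [now apply Rinv_0_lt_compat|].
  replace (INR (fact (S k)) * exp t * / INR (fact (S k))) with (exp t)
    by (field; lra).
  exact Hexp.
- apply is_lim_const.
- replace (Finite 0) with (Rbar_mult (INR (fact (S k))) 0)
    by (simpl; f_equal; ring).
  apply is_lim_scal_l.
  apply (is_lim_inv (fun t => t) p_infty p_infty); [apply is_lim_id|discriminate].
Qed.

Lemma is_lim_gamma_poly (n : nat) :
  is_lim (fun t => gamma_poly n t * exp (- t)) p_infty 0.
Proof.
induction n as [|n IH].
- apply (is_lim_ext (fun t => t ^ 0 * exp (- t))); [intros t; reflexivity|].
  apply is_lim_pow_exp_opp.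
- apply (is_lim_ext (fun t => t ^ S n * exp (- t)
      + INR (S n) * (gamma_poly n t * exp (- t)))).
  { intros t; symmetry.
    change ((t ^ S n + INR (S n) * gamma_poly n t) * exp (- t)
      = t ^ S n * exp (- t) + INR (S n) * (gamma_poly n t * exp (- t))); ring. }
  replace (Finite 0) with (Finite (0 + INR (S n) * 0)) by (f_equal; ring).
  apply (is_lim_plus' _ _ p_infty 0 (INR (S n) * 0)).
  + apply is_lim_pow_exp_opp.
  + exact (is_lim_scal_l _ (INR (S n)) p_infty 0 IH).
Qed.

(** * Integer powers, and real integrals seen as complex ones *)

Lemma Rcpow_INR (x : R) (n : nat) : 0 < x -> Rcpow x (RtoC (INR n)) = RtoC (x ^ n).
Proof.
intros Hx; unfold Rcpow, Cexp.
replace (RtoC (INR n) * RtoC (ln x))%C with (RtoC (INR n * ln x))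
  by apply RtoC_mult.
simpl Re; simpl Im.
rewrite cos_0, sin_0, Rmult_1_r, Rmult_0_r.
change (exp (INR n * ln x)) with (Rpower x (INR n)).
now rewrite Rpower_pow.
Qed.

Lemma is_RInt_RtoC (f : R -> R) (a b l : R) : is_RInt f a b l ->
  @is_RInt C_R_NormedModule (fun x => RtoC (f x)) a b (RtoC l).
Proof.
intros H.
apply (is_RInt_fct_extend_pair (U := R_NormedModule) (V := R_NormedModule)
  (fun x => RtoC (f x))); [exact H|].
replace 0 with (scal (b - a) 0)
  by (unfold scal; simpl; unfold mult; simpl; ring).
apply (is_RInt_const (V := R_NormedModule)).
Qed.

Lemma ball_RtoC (x y : R) (e : R) :
  0 < e -> Rabs (y - x) < e -> @ball C_R_NormedModule (RtoC x) e (RtoC y).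
Proof.
intros He H; split; [exact H|].
simpl snd. change (Rabs (0 - 0) < e). rewrite Rminus_diag, Rabs_R0; exact He.
Qed.

Lemma CGamma_INR (n : nat) :
  CGamma (RtoC (INR n) + RtoC 1) = RtoC (INR (fact n)).
Proof.
unfold CGamma.
apply (is_RInt_gen_unique (V := C_R_CompleteNormedModule)).
replace (RtoC (INR n) + RtoC 1 - RtoC 1)%C with (RtoC (INR n)) by ring.
set (F := fun t => - (gamma_poly n t * exp (- t))).
assert (F0 : F 0 = - INR (fact n))
  by (unfold F; rewrite gamma_poly_0, Ropp_0, exp_0; ring).
intros Q [e HQ]. pose proof (cond_pos e).
assert (Hc : continuous F 0).
{ apply (ex_derive_continuous (K := R_AbsRing) (V := R_NormedModule)).
  eexists; apply is_derive_gamma_primitive. }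
pose proof (proj1 (filterlim_locally F (F 0)) Hc (pos_div_2 e)) as [d Hd].
pose proof (proj1 (filterlim_locally _ _) (is_lim_gamma_poly n) (pos_div_2 e))
  as [A HA].
(* Each endpoint contributes an error below [e / 2]. Both are kept positive, so that [Rcpow] is a
   true power between them in whichever order they lie. *)
exists (fun x => 0 < x /\ ball 0 d x) (fun b => A < b /\ 0 < b).
- exists d; intros x Hx Hx0; now split.
- exists (Rmax A 0); intros b Hb.
  pose proof (Rmax_l A 0); pose proof (Rmax_r A 0); lra.
- intros x b [Hx0 Hx] [Hb Hb0]; simpl fst; simpl snd.
  exists (RtoC (F b - F x)); split.
  + apply (is_RInt_ext (V := C_R_NormedModule)
      (fun t => RtoC (t ^ n * exp (- t)))).
    { intros t Ht.
      assert (0 < t) by (pose proof (Rmin_glb_lt x b 0 Hx0 Hb0); lra).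
      rewrite Rcpow_INR by assumption; now rewrite <- RtoC_mult. }
    apply is_RInt_RtoC.
    apply (is_RInt_derive (V := R_CompleteNormedModule) F); intros t _.
    * apply is_derive_gamma_primitive.
    * apply (ex_derive_continuous (K := R_AbsRing) (V := R_NormedModule)).
      auto_derive; trivial.
  + apply HQ, ball_RtoC; [assumption|].
    pose proof (Hd x Hx) as H1. change (Rabs (F x - F 0) < e / 2) in H1.
    pose proof (HA b Hb) as H2.
    change (Rabs (gamma_poly n b * exp (- b) - 0) < e / 2) in H2.
    rewrite F0 in H1. apply Rabs_def2 in H1. apply Rabs_def2 in H2.
    apply Rabs_def1; unfold F at 1; lra.
Qed.

Lemma RInt_gen_pow_div_sin (n : nat) (P M : R) :
  (forall c, 0 < c < PI / 2 ->
    exists G, is_RInt (fun x => x ^ n / sin x) c (PI / 2) G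
              /\ Rabs (G - P) <= c * M) ->
  @RInt_gen C_R_CompleteNormedModule
    (fun x => (Rcpow x (RtoC (INR n)) / RtoC (sin x))%C)
    (at_right 0) (at_point (PI / 2)) = RtoC P.
Proof.
intros H. pose proof PI_RGT_0.
apply (is_RInt_gen_unique (V := C_R_CompleteNormedModule)).
intros Q [e HQ]. pose proof (cond_pos e). pose proof (Rabs_pos M).
(* The first bound makes the estimate at [c] available, the second makes [c * M] less than [e];
   adding 1 keeps the denominator positive. *)
set (d := Rmin (PI / 2) (e / (Rabs M + 1))).
assert (Hd : 0 < d)
  by (apply Rmin_pos; [lra|apply Rdiv_lt_0_compat; lra]).
exists (fun c => 0 < c < d) (fun b => b = PI / 2); [|reflexivity|].
{ exists (mkposreal d Hd); intros c Hc Hc0; split; [exact Hc0|].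
  change (Rabs (c - 0) < d) in Hc; apply Rabs_def2 in Hc; lra. }
intros c b Hc ->; simpl fst; simpl snd.
pose proof (Rmin_l (PI / 2) (e / (Rabs M + 1))) as Hl.
pose proof (Rmin_r (PI / 2) (e / (Rabs M + 1))) as Hr.
fold d in Hl, Hr.
destruct (H c ltac:(lra)) as [G [HG HGP]].
exists (RtoC G); split.
- apply (is_RInt_ext (V := C_R_NormedModule) (fun x => RtoC (x ^ n / sin x))).
  { intros x Hx. rewrite Rmin_left, Rmax_right in Hx by lra.
    rewrite Rcpow_INR by lra. apply RtoC_div.
    apply Rgt_not_eq, sin_gt_0; lra. }
  now apply is_RInt_RtoC.
- apply HQ, ball_RtoC; [assumption|].
  eapply Rle_lt_trans; [exact HGP|].
  pose proof (Rle_abs M).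
  apply Rle_lt_trans with (c * (Rabs M + 1)); [apply Rmult_le_compat_l; lra|].
  apply Rlt_le_trans with (e / (Rabs M + 1) * (Rabs M + 1));
    [apply Rmult_lt_compat_r; lra|].
  right; field; lra.
Qed.

Lemma is_series_RtoC (u : nat -> R) (l : R) : is_series u l ->
  @is_series C_AbsRing C_NormedModule (fun k => RtoC (u k)) (RtoC l).
Proof.
intros H.
assert (Hs : forall N, sum_n (G := C_NormedModule) (fun k => RtoC (u k)) N
                       = RtoC (sum_n u N)).
{ induction N as [|N IH]; [now rewrite !sum_O|].
  rewrite !sum_Sn, IH; symmetry; apply RtoC_plus. }
apply filterlim_locally; intros e.
generalize (proj1 (filterlim_locally _ _) H e).
apply filter_imp; intros N HN.
rewrite Hs; apply ball_RtoC; [apply cond_pos|exact HN].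
Qed.

Theorem theorem3 (E : nat -> R) (hE : is_Euler_numbers E)
    (n : nat) (hn : (1 <= n)%nat) :
  @is_series C_AbsRing C_NormedModule
    (fun k : nat =>
       RtoC ((-1) ^ k * E (2 * k)%nat / INR (fact (n + 2 * k + 1))
             * (PI / 2) ^ (n + 2 * k)))
    (J (RtoC (INR n))).
Proof.
destruct (csc_moment n hn) as (P & M & HP & HG).
pose proof PI_RGT_0 as Hpi. pose proof (INR_fact_neq_0 n) as Hn.
unfold J; rewrite CGamma_INR, (RInt_gen_pow_div_sin n P M HG).
rewrite <- !RtoC_div, <- !RtoC_mult by lra.
apply is_series_RtoC.
(* The scaling cancels [n!] and one factor [PI / 2] of the beta integral; its [(2 * k)!] cancels the
   denominator of the Euler coefficient. *)
eapply is_series_ext;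
  [|exact (is_series_scal (1 / INR (fact n) * (2 / PI)) _ _ HP)].
intros k; cbv beta; unfold csc_moment_term.
rewrite (Euler_numbers_sec_coef E k hE), (pow_add _ (n + 2 * k) 1), pow_1.
match goal with |- scal ?u ?v = ?w => change (u * v = w) end.
field; repeat split; try apply INR_fact_neq_0; lra.
Qed.
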